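(* Let $\theta(q,x)=\sum_{j=0}^{\infty}q^{j(j+1)/2}x^j$ for $|q|<1$, and set $\theta(1,x):=1/(1-x)$ for $x\in[-10.5,0]$. (1) For every $q\in(0,1)$, the function $\theta(q,\cdot)$ has no real zeros $\geq -6$. (2) $\theta(q,x)\neq 0$ for all $(q,x)\in\tilde Q:=[0.4,1]\times[-10.5,0]$. Moreover $\theta(q,x)\geq 0.0049$ for all $(q,x)\in\partial\tilde Q$.
   Context: The partial theta function is $\theta(q,x):=\sum_{j=0}^{\infty}q^{j(j+1)/2}x^j$; for each fixed $q$ with $|q|<1$ it is an entire function of $x$. The value $q=1$ is allowed by the convention $\theta(1,x)=1/(1-x)$, which is the limit of $\theta(q,x)$ as $q\to1^-$, uniform on compact subsets of the interior of the closed curve $x=e^{t\pm it}$, $t\in[0,\pi]$ (this interior contains $[-10.5,0]$). $\partial\tilde Q$ is the boundary of the rectangle $\tilde Q\subset\mathbb{R}^2$. *)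

(* Defs.v *)
From Stdlib Require Import Reals Lra Lia.
From Coquelicot Require Import Coquelicot.
Open Scope R_scope.

Definition theta_coef (q x : R) (j : nat) : R :=
  q ^ Nat.div (j * (j + 1)) 2 * x ^ j.

(* [Series] is a total operator; [ex_series_theta] below shows that it denotes
   a genuine sum for |q| < 1. The branch q = 1 is only meaningful for x in the
   region where 1/(1-x) is the limit of theta(q,x) as q -> 1-, which contains
   [-10.5, 0]. *)
Definition theta (q x : R) : R :=
  if Req_EM_T q 1 then 1 / (1 - x) else Series (theta_coef q x).

Definition Qtilde (p : R * R) : Prop :=
  0.4 <= fst p <= 1 /\ -10.5 <= snd p <= 0.

(* Closure minus interior: [locally p D] says that p is interior to D. *)
Definition boundary {T : UniformSpace} (D : T -> Prop) (p : T) : Prop :=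
  ~ locally p (fun y => ~ D y) /\ ~ locally p D.

Lemma theta_coef_S (q x : R) (j : nat) :
  theta_coef q x (S j) = q ^ S j * x * theta_coef q x j.
Proof.
unfold theta_coef.
replace (S j * (S j + 1))%nat with (j * (j + 1) + S j * 2)%nat by lia.
rewrite Nat.div_add by discriminate.
rewrite pow_add. simpl. ring.
Qed.

Lemma ex_series_theta (q x : R) : Rabs q < 1 -> ex_series (theta_coef q x).
Proof.
intros Hq.
destruct (Req_dec (q * x) 0) as [Hz | Hz].
- apply (proj2 (ex_series_incr_1 _)).
  apply ex_series_ext with (fun _ => 0).
    intros n. rewrite theta_coef_S. simpl.
    replace (q * q ^ n * x) with (q * x * q ^ n) by ring.
    rewrite Hz. ring.
  exists 0. apply filterlim_ext with (fun _ => 0).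
    intros n. rewrite sum_n_const. ring.
  apply filterlim_const.
- assert (Hq0 : q <> 0) by (intros E; apply Hz; rewrite E; ring).
  assert (Hx0 : x <> 0) by (intros E; apply Hz; rewrite E; ring).
  assert (Hn : forall n, theta_coef q x n <> 0).
    intros n. unfold theta_coef.
    apply Rmult_integral_contrapositive_currified; now apply pow_nonzero.
  apply ex_series_Rabs.
  apply ex_series_DAlembert with 0; [lra | exact Hn |].
  apply is_lim_seq_ext with (fun n => Rabs (q * x) * Rabs q ^ n).
    intros n. rewrite theta_coef_S.
    replace (q ^ S n * x * theta_coef q x n / theta_coef q x n)
      with (q * x * q ^ n) by (simpl; field; apply Hn).
    now rewrite RPow_abs, <- Rabs_mult.
  replace (Finite 0) with (Rbar_mult (Rabs (q * x)) 0)
    by (simpl; f_equal; ring).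
  apply is_lim_seq_scal_l, is_lim_seq_geom.
  now rewrite Rabs_Rabsolu.
Qed.

(* Main.v *)
(** As a function of [(q, x)], [theta] solves the parabolic equation
    [2 q theta_q = x^2 theta_xx + 2 x theta_x], with time [q] running forward. By
    the minimum principle a lower bound on [q0, q1] x [-Y, 0] follows from one on
    the parts [q = q0], [x = 0] and [x = -Y] of the boundary: with [q0 = 0.4],
    [Y = 10.5] for the second statement, and with [q0 = 1/6], [Y = 6] for the
    first one when [q < 0.4].

    On the walls [x = -Y], for [q <= 2/3], the bound is checked on truncations of
    the alternating series. Nearer to [q = 1], write [theta q (-y)] as
    [theta q (-1/y) / y + bitheta q y], where [bitheta] is the two-sided theta
    series. In the variables [q = exp (- 1 / (2 t))], [y = exp (z / (2 t))], and
    up to a Gaussian factor, [bitheta] is an antiperiodic solution in [z] of the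
    heat equation that vanishes at integers, and so it decays exponentially
    in [t]. Comparing it on [0 <= z <= 1] with
    [exp (- 6 t) (1 - 3 (z - 1/2)^2)] suffices, because the Gaussian factor grows
    like [exp ((ln 10.5)^2 t)] and [(ln 10.5)^2 < 6]. *)

Require Import Defs.
From Stdlib Require Import Reals Lra Lia ClassicalEpsilon ZArith List.
From Coquelicot Require Import Coquelicot.
Open Scope R_scope.

(** * The parabolic minimum principle *)

(** Minimize in [y] for each [x], then minimize the resulting function of [x], which inherits
    continuity from the uniform continuity of [f]. *)
Lemma continuity_2d_min (f : R -> R -> R) (a b c d : R) :
  a <= b -> c <= d ->
  (forall x y, a <= x <= b -> c <= y <= d -> continuity_2d_pt f x y) ->
  exists x0 y0, a <= x0 <= b /\ c <= y0 <= d /\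
    forall x y, a <= x <= b -> c <= y <= d -> f x0 y0 <= f x y.
Proof.
intros Hab Hcd Hf.
assert (Hy : forall x, exists y, a <= x <= b ->
    c <= y <= d /\ forall z, c <= z <= d -> f x y <= f x z).
  intros x.
  destruct (excluded_middle_informative (a <= x <= b)) as [Hx | Hx].
  - destruct (continuity_ab_min (f x) c d Hcd) as [y [H1 H2]].
      intros y Hy eps Heps.
      destruct (Hf x y Hx Hy (mkposreal eps Heps)) as [del Hdel].
      exists del. split; [apply cond_pos |].
      intros z [_ Hz]. apply Hdel; [| exact Hz].
      rewrite Rminus_diag, Rabs_R0. apply cond_pos.
    exists y. intros _. now split.
  - exists c. tauto.
set (Y := fun x => proj1_sig (constructive_indefinite_description _ (Hy x))).
assert (HY : forall x, a <= x <= b ->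
    c <= Y x <= d /\ forall z, c <= z <= d -> f x (Y x) <= f x z).
  intros x. exact (proj2_sig (constructive_indefinite_description _ (Hy x))).
(* The one-dimensional theorem asks for two-sided continuity even at [a] and [b], whereas [Y] is
   controlled on [[a, b]] only; the 1-Lipschitz retraction [cl] bridges this. *)
set (cl := fun x => Rmax a (Rmin b x)).
assert (Hcl : forall x, a <= cl x <= b).
  intros x. unfold cl. split; [apply Rmax_l |].
  apply Rmax_lub; [lra | apply Rmin_l].
assert (Hcl_id : forall x, a <= x <= b -> cl x = x).
  intros x Hx. unfold cl. rewrite Rmin_right, Rmax_right; lra.
assert (Hcl_lip : forall x y, Rabs (cl x - cl y) <= Rabs (x - y)).
  intros x y. unfold cl, Rmax, Rmin, Rabs.
  repeat destruct Rle_dec; repeat destruct Rcase_abs; lra.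
destruct (continuity_ab_min (fun x => f (cl x) (Y (cl x))) a b Hab)
  as [x0 [H1 H2]].
  intros x Hx eps Heps.
  destruct (uniform_continuity_2d f a b c d Hf (mkposreal eps Heps))
    as [del Hdel].
  exists del. split; [apply cond_pos |].
  intros y [_ Hxy]. unfold R_met, R_dist in *. simpl in *.
  assert (Hn : Rabs (cl y - cl x) < del)
    by (eapply Rle_lt_trans; [apply Hcl_lip | exact Hxy]).
  assert (H0 : forall z, Rabs (z - z) < del).
    intros z. rewrite Rminus_diag, Rabs_R0. apply cond_pos.
  destruct (HY (cl x) (Hcl x)) as [Hx1 Hx2].
  destruct (HY (cl y) (Hcl y)) as [Hy1 Hy2].
  pose proof (Hdel (cl x) (Y (cl x)) (cl y) (Y (cl x)) (Hcl x) Hx1 (Hcl y) Hx1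
    Hn (H0 _)) as E1.
  pose proof (Hdel (cl x) (Y (cl y)) (cl y) (Y (cl y)) (Hcl x) Hy1 (Hcl y) Hy1
    Hn (H0 _)) as E2.
  specialize (Hx2 _ Hy1). specialize (Hy2 _ Hx1).
  apply Rabs_def2 in E1. apply Rabs_def2 in E2. apply Rabs_def1; lra.
exists x0, (Y x0).
destruct (HY x0 H2) as [H3 H4].
repeat split; try tauto; try lra.
intros x y Hx Hy'. specialize (H1 x Hx). rewrite !Hcl_id in H1 by tauto.
apply Rle_trans with (1 := H1). now apply HY.
Qed.

(** One-sided, because a minimum may sit at the final time, where only earlier times are available
    for comparison. *)
Lemma deriv_le_0_left_min (f : R -> R) (x l r : R) :
  r < x -> is_derive f x l -> (forall y, r <= y <= x -> f x <= f y) -> l <= 0.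
Proof.
intros Hr Hd Hm.
destruct (Rle_lt_dec l 0) as [| Hl]; [easy | exfalso].
apply is_derive_Reals in Hd.
destruct (Hd l Hl) as [del Hdel].
set (h := Rmin (del / 2) (x - r)).
assert (Hh : 0 < h <= x - r /\ h < del).
  pose proof (cond_pos del). unfold h, Rmin. destruct Rle_dec; lra.
specialize (Hdel (- h)).
rewrite Rabs_Ropp, (Rabs_pos_eq h) in Hdel by lra.
specialize (Hdel ltac:(lra) ltac:(lra)).
specialize (Hm (x + - h) ltac:(lra)).
apply Rabs_def2 in Hdel.
assert (E : (f (x + - h) - f x) / - h <= 0).
  apply Rmult_le_reg_r with h; [lra |].
  replace ((f (x + - h) - f x) / - h * h) with (- (f (x + - h) - f x))
    by (field; lra).
  lra.
lra.
Qed.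

Lemma deriv_interior_min (f : R -> R) (x l a b : R) :
  a < x < b -> is_derive f x l -> (forall y, a < y < b -> f x <= f y) -> l = 0.
Proof.
intros Hx Hd Hm.
apply Rle_antisym.
- apply deriv_le_0_left_min with f x ((a + x) / 2); [lra | easy |].
  intros y Hy. apply Hm. lra.
- assert (- l <= 0); [| lra].
  apply deriv_le_0_left_min with (fun y => f (- y)) (- x) (- ((x + b) / 2));
    [lra | | intros y Hy; rewrite Ropp_involutive; apply Hm; lra].
  evar_last.
    apply (is_derive_comp f Ropp).
      rewrite Ropp_involutive. exact Hd.
    apply (is_derive_opp (fun y : R => y)). apply is_derive_id.
  unfold scal, opp, one; simpl; unfold mult; simpl. ring.
Qed.

(** If [l < 0], then [f'] is negative just to the right of [x], and by the mean value theorem [f]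
    dips below [f x] there. *)
Lemma deriv2_interior_min (f f' : R -> R) (x l a b : R) :
  a < x < b -> (forall y, a < y < b -> is_derive f y (f' y)) ->
  is_derive f' x l -> (forall y, a < y < b -> f x <= f y) -> 0 <= l.
Proof.
intros Hx Hd Hd2 Hm.
destruct (Rle_lt_dec 0 l) as [| Hl]; [easy | exfalso].
assert (H0 : f' x = 0)
  by (apply deriv_interior_min with f x a b; auto).
apply is_derive_Reals in Hd2.
destruct (Hd2 (- l) ltac:(lra)) as [del Hdel].
set (h := Rmin (del / 2) ((b - x) / 2)).
assert (Hh : 0 < h < b - x /\ h < del).
  pose proof (cond_pos del). unfold h, Rmin. destruct Rle_dec; lra.
destruct (MVT_cor2 f f' x (x + h)) as [c [Hc1 Hc2]]; [lra | |].
  intros c Hc. apply is_derive_Reals, Hd. lra.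
specialize (Hdel (c - x) ltac:(lra)).
rewrite Rabs_pos_eq in Hdel by lra.
specialize (Hdel ltac:(lra)).
replace (x + (c - x)) with c in Hdel by ring.
rewrite H0, Rminus_0_r in Hdel.
apply Rabs_def2 in Hdel.
assert (Hq : f' c / (c - x) < 0) by lra.
assert (Hf : f' c < 0).
  apply Rmult_lt_reg_r with (/ (c - x)); [apply Rinv_0_lt_compat; lra |].
  unfold Rdiv in Hq. lra.
specialize (Hm (x + h) ltac:(lra)).
nra.
Qed.

(* The last hypothesis holds for every supersolution of an equation
   [alpha f_t = beta f_zz + gamma f_z] with [alpha > 0] and [beta >= 0]. *)
Lemma parabolic_min (f ft fz fzz : R -> R -> R) (t0 t1 a b m : R) :
  a <= b ->
  (forall t z, t0 <= t <= t1 -> a <= z <= b -> continuity_2d_pt f t z) ->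
  (forall t z, t0 < t <= t1 -> a < z < b ->
    is_derive (fun t => f t z) t (ft t z) /\
    is_derive (fun z => f t z) z (fz t z) /\
    is_derive (fun z => fz t z) z (fzz t z)) ->
  (forall t z, t0 < t <= t1 -> a < z < b ->
    fz t z = 0 -> 0 <= fzz t z -> 0 <= ft t z) ->
  (forall z, a <= z <= b -> m <= f t0 z) ->
  (forall t, t0 <= t <= t1 -> m <= f t a /\ m <= f t b) ->
  forall t z, t0 <= t <= t1 -> a <= z <= b -> m <= f t z.
Proof.
intros Hab Hc Hd Hs Hbase Hwall t z Ht Hz.
destruct (Rle_lt_dec m (f t z)) as [| Hlt]; [easy | exfalso].
(* Adding [e * (t - t0)] makes the supersolution strict. This [e] is small enough that the perturbed
   value at [(t, z)] stays below [m], which keeps the perturbed minimum off the base and the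
   walls. *)
set (e := (m - f t z) / (2 * (t1 - t0 + 1))).
assert (He : 0 < e) by (apply Rdiv_lt_0_compat; lra).
assert (He' : e * (2 * (t1 - t0 + 1)) = m - f t z) by (unfold e; field; lra).
destruct (continuity_2d_min (fun t z => f t z + e * (t - t0)) t0 t1 a b)
  as [x [y [Hx [Hy Hmin]]]]; [lra | easy | |].
  intros u v Hu Hv.
  apply (continuity_2d_pt_plus f); [now apply Hc |].
  apply (continuity_2d_pt_mult (fun _ _ => e)); [apply continuity_2d_pt_const |].
  apply continuity_2d_pt_minus;
    [apply continuity_2d_pt_id1 | apply continuity_2d_pt_const].
assert (Hval : f x y + e * (x - t0) < m).
  apply Rle_lt_trans with (1 := Hmin t z Ht Hz). nra.
assert (Hx0 : t0 < x).
  destruct (Rle_lt_dec x t0) as [Hle |]; [| easy].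
  replace x with t0 in Hval by lra. specialize (Hbase y Hy). lra.
assert (Hfm : f x y < m) by nra.
assert (Hya : a < y).
  destruct (Rle_lt_dec y a) as [Hle |]; [| easy].
  replace y with a in Hfm by lra. specialize (Hwall x Hx). lra.
assert (Hyb : y < b).
  destruct (Rle_lt_dec b y) as [Hle |]; [| easy].
  replace y with b in Hfm by lra. specialize (Hwall x Hx). lra.
assert (Hmz : forall v, a < v < b -> f x y <= f x v).
  intros v Hv. specialize (Hmin x v Hx ltac:(lra)). lra.
destruct (Hd x y ltac:(lra) ltac:(lra)) as [D1 [D2 D3]].
assert (E1 : fz x y = 0)
  by (apply deriv_interior_min with (fun z => f x z) y a b; auto; lra).
assert (E2 : 0 <= fzz x y).
  apply deriv2_interior_min with (fun z => f x z) (fun z => fz x z) y a b; auto.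
  intros v Hv. apply Hd; lra.
specialize (Hs x y ltac:(lra) ltac:(lra) E1 E2).
assert (ft x y + e <= 0); [| lra].
apply deriv_le_0_left_min with (fun t => f t y + e * (t - t0)) x t0; [lra | |].
  apply (is_derive_plus (fun t => f t y)); [easy |].
  auto_derive; [easy | ring].
intros u Hu. apply Hmin; lra.
Qed.

(** Only the approximants [F n] are differentiated. The bound loses [e n] when passing from [f] to
    [F n] on the boundary, and [e n] again on the way back. *)
Lemma parabolic_min_limit (F Ft Fz Fzz : nat -> R -> R -> R) (f : R -> R -> R)
    (e : nat -> R) (t0 t1 a b m : R) :
  a <= b ->
  (forall n t z, t0 <= t <= t1 -> a <= z <= b -> continuity_2d_pt (F n) t z) ->
  (forall n t z, t0 < t <= t1 -> a < z < b ->
    is_derive (fun t => F n t z) t (Ft n t z) /\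
    is_derive (fun z => F n t z) z (Fz n t z) /\
    is_derive (fun z => Fz n t z) z (Fzz n t z)) ->
  (forall n t z, t0 < t <= t1 -> a < z < b ->
    Fz n t z = 0 -> 0 <= Fzz n t z -> 0 <= Ft n t z) ->
  (forall n t z, t0 <= t <= t1 -> a <= z <= b ->
    Rabs (F n t z - f t z) <= e n) ->
  is_lim_seq e 0 ->
  (forall z, a <= z <= b -> m <= f t0 z) ->
  (forall t, t0 <= t <= t1 -> m <= f t a /\ m <= f t b) ->
  forall t z, t0 <= t <= t1 -> a <= z <= b -> m <= f t z.
Proof.
intros Hab Hc Hd Hs Hu He Hbase Hwall t z Ht Hz.
assert (H : forall n, m - 2 * e n <= f t z).
  intros n.
  assert (B : forall t z, t0 <= t <= t1 -> a <= z <= b ->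
      f t z - e n <= F n t z <= f t z + e n).
    intros u v Hu' Hv. specialize (Hu n u v Hu' Hv).
    apply Rabs_le_between in Hu. lra.
  assert (m - e n <= F n t z); [| specialize (B t z Ht Hz); lra].
  apply (parabolic_min (F n) (Ft n) (Fz n) (Fzz n) t0 t1 a b);
    try easy; try (now auto).
  - intros v Hv. specialize (Hbase v Hv). specialize (B t0 v ltac:(lra) Hv). lra.
  - intros u Hu'. specialize (Hwall u Hu').
    pose proof (B u a Hu' ltac:(lra)). pose proof (B u b Hu' ltac:(lra)). lra.
apply (is_lim_seq_le (fun n => m - 2 * e n) (fun _ => f t z) m (f t z) H);
  [| apply is_lim_seq_const].
replace (Finite m) with (Finite (m - 2 * 0)) by (f_equal; ring).
apply is_lim_seq_minus'; [apply is_lim_seq_const |].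
now apply (is_lim_seq_scal_l e 2 0).
Qed.

(** * Partial sums of theta *)

Definition theta_trunc (n : nat) (q x : R) : R := sum_n (theta_coef q x) n.

Lemma theta_coef_shift (q x : R) (j : nat) :
  theta_coef q x (S j) = q * x * theta_coef q (q * x) j.
Proof.
rewrite theta_coef_S. unfold theta_coef. rewrite Rpow_mult_distr. simpl. ring.
Qed.

Lemma theta_coef_0 (q x : R) : theta_coef q x 0 = 1.
Proof. unfold theta_coef. simpl. ring. Qed.

Lemma theta_trunc_0 (q x : R) : theta_trunc 0 q x = 1.
Proof. unfold theta_trunc. rewrite sum_O. apply theta_coef_0. Qed.

Lemma theta_trunc_last (n : nat) (q x : R) :
  theta_trunc (S n) q x = theta_trunc n q x + theta_coef q x (S n).
Proof. unfold theta_trunc. now rewrite sum_Sn. Qed.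

(** Finite form of the functional equation of theta; it drives the inductions on the truncation
    order. *)
Lemma theta_trunc_S (n : nat) (q x : R) :
  theta_trunc (S n) q x = 1 + q * x * theta_trunc n q (q * x).
Proof.
induction n as [| n IH].
- rewrite theta_trunc_last, !theta_trunc_0, theta_coef_shift, theta_coef_0. ring.
- rewrite theta_trunc_last, IH, theta_coef_shift, (theta_trunc_last n). ring.
Qed.

Lemma is_lim_theta_trunc (q x : R) :
  0 <= q < 1 -> is_lim_seq (fun n => theta_trunc n q x) (theta q x).
Proof.
intros Hq. unfold theta. destruct Req_EM_T as [E | _]; [lra |].
apply (Series_correct (theta_coef q x)), ex_series_theta.
rewrite Rabs_pos_eq; lra.
Qed.

Lemma theta_functional (q x : R) :
  0 <= q < 1 -> theta q x = 1 + q * x * theta q (q * x).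
Proof.
intros Hq.
pose proof (is_lim_seq_incr_1 (fun n => theta_trunc n q x) (theta q x)) as [H _].
specialize (H (is_lim_theta_trunc q x Hq)).
apply is_lim_seq_unique in H.
assert (H' : is_lim_seq (fun n => theta_trunc (S n) q x)
    (1 + q * x * theta q (q * x))).
  apply is_lim_seq_ext with (fun n => 1 + q * x * theta_trunc n q (q * x)).
    intros n. now rewrite theta_trunc_S.
  apply is_lim_seq_plus'; [apply is_lim_seq_const |].
  apply (is_lim_seq_scal_l _ (q * x) (theta q (q * x))).
  now apply is_lim_theta_trunc.
apply is_lim_seq_unique in H'. congruence.
Qed.

Lemma theta_at_0 (q : R) : 0 <= q < 1 -> theta q 0 = 1.
Proof. intros Hq. rewrite theta_functional by easy. ring. Qed.

Lemma theta_ge_1 (q x : R) : 0 <= q < 1 -> 0 <= x -> 1 <= theta q x.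
Proof.
intros Hq Hx.
assert (Hn : forall n x, 0 <= x -> 1 <= theta_trunc n q x).
  induction n as [| n IH]; intros y Hy; [rewrite theta_trunc_0; lra |].
  rewrite theta_trunc_S.
  pose proof (Rmult_le_pos q y (proj1 Hq) Hy). specialize (IH (q * y) H). nra.
exact (is_lim_seq_le _ _ 1 (theta q x) (fun n => Hn n x Hx)
  (is_lim_seq_const 1) (is_lim_theta_trunc q x Hq)).
Qed.

(** The recursion [1 - q * y * T] keeps [T] in [[0, 1]], and replacing [y] by [q * y] preserves the
    hypothesis. *)
Lemma theta_neg_01 (q y : R) :
  0 <= q < 1 -> 0 <= y -> q * y <= 1 -> 0 <= theta q (- y) <= 1.
Proof.
intros Hq Hy Hqy.
assert (Hn : forall n y, 0 <= y -> q * y <= 1 -> 0 <= theta_trunc n q (- y) <= 1).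
  induction n as [| n IH]; intros z Hz Hqz; [rewrite theta_trunc_0; lra |].
  rewrite theta_trunc_S. replace (q * - z) with (- (q * z)) by ring.
  pose proof (Rmult_le_pos q z (proj1 Hq) Hz).
  specialize (IH (q * z) H ltac:(nra)). nra.
split.
- exact (is_lim_seq_le _ _ 0 (theta q (- y)) (fun n => proj1 (Hn n y Hy Hqy))
    (is_lim_seq_const 0) (is_lim_theta_trunc q (- y) Hq)).
- exact (is_lim_seq_le _ _ (theta q (- y)) 1 (fun n => proj2 (Hn n y Hy Hqy))
    (is_lim_theta_trunc q (- y) Hq) (is_lim_seq_const 1)).
Qed.

(** The terms may grow at first: [q ^ S n * y] is the ratio of term [n + 1] to term [n] in absolute
    value, so they decrease from index [n] on. In the induction, the factor [- q * y] of the
    functional equation flips the inequality. *)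
Lemma theta_trunc_alternating (n : nat) (q y : R) :
  0 <= q < 1 -> 0 <= y -> q ^ S n * y <= 1 ->
  if Nat.even n then theta q (- y) <= theta_trunc n q (- y)
  else theta_trunc n q (- y) <= theta q (- y).
Proof.
intros Hq. revert y. induction n as [| n IH]; intros y Hy Hqy.
- simpl in *. rewrite theta_trunc_0. apply theta_neg_01; [easy | easy | lra].
- assert (Hqy0 : 0 <= q * y) by (apply Rmult_le_pos; lra).
  specialize (IH (q * y) Hqy0).
  rewrite Nat.even_succ, <- Nat.negb_even.
  rewrite theta_functional, theta_trunc_S by easy.
  replace (q * - y) with (- (q * y)) by ring.
  assert (Hqy' : q ^ S n * (q * y) <= 1)
    by (simpl in *; lra).
  specialize (IH Hqy').
  destruct (Nat.even n); simpl; nra.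
Qed.

Lemma theta_neg_ge_linear (q y : R) :
  0 <= q < 1 -> 0 <= y <= 1 -> 1 - q * y <= theta q (- y).
Proof.
intros Hq Hy.
pose proof (theta_trunc_alternating 1 q y Hq (proj1 Hy)) as H. simpl in H.
rewrite theta_trunc_S, theta_trunc_0 in H.
replace (1 - q * y) with (1 + q * - y * 1) by ring. apply H. nra.
Qed.

(** Two uses of the functional equation, then the linear bound at [q * (q * y) <= q]. The quadratic
    term keeps the bound positive even when [q * y = 1]. *)
Lemma theta_neg_ge (q y : R) :
  0 <= q < 1 -> 0 <= y -> q * y <= 1 ->
  1 - q * y + (q * y) ^ 2 * q * (1 - q ^ 2) <= theta q (- y).
Proof.
intros Hq Hy Hqy.
assert (H0 : 0 <= q * y) by (apply Rmult_le_pos; lra).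
rewrite theta_functional by easy.
replace (q * - y) with (- (q * y)) by ring.
rewrite theta_functional by easy.
replace (q * - (q * y)) with (- (q * (q * y))) by ring.
assert (H1 : 0 <= q * (q * y) <= q) by (split; [apply Rmult_le_pos; lra | nra]).
pose proof (theta_neg_ge_linear q (q * (q * y)) Hq ltac:(lra)) as H.
assert (H2 : 1 - q ^ 2 <= theta q (- (q * (q * y)))) by nra.
replace (1 + - (q * y) * (1 + - (q * (q * y)) * theta q (- (q * (q * y)))))
  with (1 - q * y + (q * y) ^ 2 * q * theta q (- (q * (q * y)))) by ring.
apply Rplus_le_compat_l, Rmult_le_compat_l; [| easy].
apply Rmult_le_pos; [apply pow2_ge_0 | lra].
Qed.

Lemma theta_coef_le (q x q1 Y : R) (j : nat) :
  0 <= q <= q1 -> Rabs x <= Y -> Rabs (theta_coef q x j) <= theta_coef q1 Y j.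
Proof.
intros Hq Hx. unfold theta_coef.
rewrite Rabs_mult, <- !RPow_abs, (Rabs_pos_eq q) by lra.
apply Rmult_le_compat; try (apply pow_le; try lra; apply Rabs_pos);
  apply pow_incr; [lra | split; [apply Rabs_pos | easy]].
Qed.

(** Termwise domination by the series at [(q1, Y)] makes the truncation error uniform over a
    rectangle. *)
Lemma theta_trunc_error (n : nat) (q x q1 Y : R) :
  0 <= q <= q1 -> q1 < 1 -> Rabs x <= Y ->
  Rabs (theta_trunc n q x - theta q x) <= theta q1 Y - theta_trunc n q1 Y.
Proof.
intros Hq Hq1 Hx.
assert (H : forall k, Rabs (theta_trunc n q x - theta_trunc (k + n) q x) <=
    theta_trunc (k + n) q1 Y - theta_trunc n q1 Y).
  induction k as [| k IH]; simpl.
    rewrite !Rminus_diag, Rabs_R0. lra.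
  rewrite !theta_trunc_last.
  pose proof (theta_coef_le q x q1 Y (S (k + n)) Hq Hx) as Hc.
  apply Rabs_le_between in Hc. apply Rabs_le_between in IH.
  apply Rabs_le_between. lra.
assert (L : forall q x, 0 <= q < 1 ->
    is_lim_seq (fun k => theta_trunc (k + n) q x) (theta q x)).
  intros u v Hu. apply (is_lim_seq_incr_n (fun k => theta_trunc k u v)).
  now apply is_lim_theta_trunc.
eapply (is_lim_seq_le _ _ (Rabs (theta_trunc n q x - theta q x))
  (theta q1 Y - theta_trunc n q1 Y) H).
- apply (is_lim_seq_abs _ (theta_trunc n q x - theta q x)).
  apply is_lim_seq_minus'; [apply is_lim_seq_const | apply L; lra].
- apply is_lim_seq_minus'; [apply L; lra | apply is_lim_seq_const].
Qed.

Lemma is_lim_theta_tail (q x : R) :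
  0 <= q < 1 -> is_lim_seq (fun n => theta q x - theta_trunc n q x) 0.
Proof.
intros Hq. replace (Finite 0) with (Finite (theta q x - theta q x))
  by (f_equal; ring).
apply is_lim_seq_minus'; [apply is_lim_seq_const | now apply is_lim_theta_trunc].
Qed.

(** * The minimum principle for theta *)

Definition tri (j : nat) : nat := Nat.div (j * (j + 1)) 2.

Lemma tri_S (j : nat) : tri (S j) = (tri j + S j)%nat.
Proof.
unfold tri. replace (S j * (S j + 1))%nat with (j * (j + 1) + S j * 2)%nat by lia.
now rewrite Nat.div_add by discriminate.
Qed.

Lemma tri_double (j : nat) : 2 * INR (tri j) = INR j * (INR j + 1).
Proof.
induction j as [| j IH]; [simpl; ring |].
rewrite tri_S, plus_INR, !S_INR. lra.
Qed.

(** Holds at [n = 0] too, where [Nat.pred 0 = 0] but the factor [INR 0] vanishes. *)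
Lemma mult_pow_pred (n : nat) (x : R) :
  INR n * x ^ Nat.pred n * x = INR n * x ^ n.
Proof. destruct n; simpl; ring. Qed.

Lemma continuity_2d_pow (f : R -> R -> R) (n : nat) (x y : R) :
  continuity_2d_pt f x y -> continuity_2d_pt (fun u v => f u v ^ n) x y.
Proof.
intros Hf. induction n as [| n IH]; [apply (continuity_2d_pt_const x y 1) |].
now apply (continuity_2d_pt_mult f).
Qed.

Lemma continuity_2d_sum (f : nat -> R -> R -> R) (n : nat) (x y : R) :
  (forall j, continuity_2d_pt (f j) x y) ->
  continuity_2d_pt (fun u v => sum_n (fun j => f j u v) n) x y.
Proof.
intros Hf. induction n as [| n IH].
- apply continuity_2d_pt_ext with (f 0%nat); [| easy].
  intros u v. now rewrite sum_O.
- apply continuity_2d_pt_ext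
    with (fun u v => sum_n (fun j => f j u v) n + f (S n) u v).
    intros u v. now rewrite sum_Sn.
  now apply (continuity_2d_pt_plus _ (f (S n))).
Qed.

Lemma is_derive_sum_n_R (f f' : nat -> R -> R) (n : nat) (x : R) :
  (forall j, is_derive (f j) x (f' j x)) ->
  is_derive (fun y => sum_n (fun j => f j y) n) x (sum_n (fun j => f' j x) n).
Proof. intros H. apply (is_derive_sum_n f). auto. Qed.

(* In the variable [x], [theta] solves [2 q theta_q = x^2 theta_xx + 2 x theta_x],
   because [2 (j (j + 1) / 2) = j (j - 1) + 2 j]. Time [q] runs forward, so the
   minimum over a rectangle is attained on its parabolic boundary. *)
Lemma theta_min_principle (q0 q1 Y m : R) :
  0 < q0 <= q1 -> q1 < 1 -> 0 <= Y -> m <= 1 ->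
  (forall y, 0 <= y <= Y -> m <= theta q0 (- y)) ->
  (forall q, q0 <= q <= q1 -> m <= theta q (- Y)) ->
  forall q y, q0 <= q <= q1 -> 0 <= y <= Y -> m <= theta q (- y).
Proof.
intros Hq0 Hq1 HY Hm Hbase Hwall q y Hq Hy.
rewrite <- (Ropp_involutive Y) in Hwall.
set (p := fun (j : nat) (t z : R) => t ^ tri j * z ^ j).
set (pt := fun (j : nat) (t z : R) => INR (tri j) * t ^ Nat.pred (tri j) * z ^ j).
set (pz := fun (j : nat) (t z : R) => t ^ tri j * (INR j * z ^ Nat.pred j)).
set (pzz := fun (j : nat) (t z : R) =>
  t ^ tri j * (INR j * (INR (Nat.pred j) * z ^ Nat.pred (Nat.pred j)))).
apply (parabolic_min_limit
  (fun n t z => sum_n (fun j => p j t z) n)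
  (fun n t z => sum_n (fun j => pt j t z) n)
  (fun n t z => sum_n (fun j => pz j t z) n)
  (fun n t z => sum_n (fun j => pzz j t z) n)
  theta (fun n => theta q1 Y - theta_trunc n q1 Y) q0 q1 (- Y) 0);
  try easy; try lra.
- intros n t z _ _. apply continuity_2d_sum. intros j.
  apply (continuity_2d_pt_mult (fun t _ => t ^ tri j) (fun _ z => z ^ j));
    apply continuity_2d_pow;
    [apply continuity_2d_pt_id1 | apply continuity_2d_pt_id2].
- intros n t z _ _. split; [| split].
  + apply (is_derive_sum_n_R (fun j t => p j t z) (fun j t => pt j t z)).
    intros j. unfold p, pt. auto_derive; [easy | ring].
  + apply (is_derive_sum_n_R (fun j z => p j t z) (fun j z => pz j t z)).
    intros j. unfold p, pz. auto_derive; [easy | ring].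
  + apply (is_derive_sum_n_R (fun j z => pz j t z) (fun j z => pzz j t z)).
    intros j. unfold pz, pzz. auto_derive; [easy | ring].
- intros n t z Ht _ Hz Hzz.
  assert (E : 2 * t * sum_n (fun j => pt j t z) n =
      z ^ 2 * sum_n (fun j => pzz j t z) n + 2 * z * sum_n (fun j => pz j t z) n).
    clear Hz Hzz. induction n as [| n IH].
      rewrite !sum_O. unfold pt, pz, pzz. simpl. ring.
    rewrite !sum_Sn. unfold plus. simpl.
    rewrite !Rmult_plus_distr_l, IH.
    assert (H : 2 * t * pt (S n) t z =
        z ^ 2 * pzz (S n) t z + 2 * z * pz (S n) t z).
      unfold pt, pz, pzz.
      replace (2 * t * (INR (tri (S n)) * t ^ Nat.pred (tri (S n)) * z ^ S n))
        with (2 * (INR (tri (S n)) * t ^ Nat.pred (tri (S n)) * t) * z ^ S n)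
        by ring.
      rewrite mult_pow_pred.
      replace (2 * (INR (tri (S n)) * t ^ tri (S n)) * z ^ S n)
        with (2 * INR (tri (S n)) * t ^ tri (S n) * z ^ S n) by ring.
      rewrite tri_double. simpl Nat.pred.
      pose proof (mult_pow_pred n z) as P.
      replace (z ^ 2 * (t ^ tri (S n) *
          (INR (S n) * (INR n * z ^ Nat.pred n))))
        with (z * (t ^ tri (S n) *
          (INR (S n) * (INR n * z ^ Nat.pred n * z)))) by ring.
      rewrite P, S_INR. simpl pow. ring.
    simpl in H. lra.
  rewrite Hz, Rmult_0_r, Rplus_0_r in E.
  assert (0 <= 2 * t * sum_n (fun j => pt j t z) n)
    by (rewrite E; apply Rmult_le_pos; [apply pow2_ge_0 | easy]).
  apply Rmult_le_reg_l with (2 * t); lra.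
- intros n t z Ht Hz. apply (theta_trunc_error n t z q1 Y); [lra | easy |].
  rewrite Rabs_left1; lra.
- apply is_lim_theta_tail. lra.
- intros z Hz. rewrite <- (Ropp_involutive z). apply Hbase. lra.
- intros t Ht. rewrite theta_at_0 by lra. split; [| easy].
  specialize (Hwall t Ht). now rewrite !Ropp_involutive in Hwall.
Qed.

(** * Certified lower bounds for polynomials *)

Fixpoint peval (l : list Z) (x : R) : R :=
  match l with
  | nil => 0
  | (c :: l)%list => IZR c + x * peval l x
  end.

Fixpoint padd (l m : list Z) : list Z :=
  match l, m with
  | nil, _ => m
  | _, nil => l
  | (c :: l)%list, (d :: m)%list => ((c + d)%Z :: padd l m)%list
  end.

Definition pscale (k : Z) (l : list Z) : list Z := List.map (Z.mul k) l.

Definition pshift (n : nat) (l : list Z) : list Z := (List.repeat 0%Z n ++ l)%list.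

Lemma peval_add (l m : list Z) (x : R) :
  peval (padd l m) x = peval l x + peval m x.
Proof.
revert m. induction l as [| c l IH]; intros [| d m]; simpl; try ring.
rewrite IH, plus_IZR. ring.
Qed.

Lemma peval_scale (k : Z) (l : list Z) (x : R) :
  peval (pscale k l) x = IZR k * peval l x.
Proof.
induction l as [| c l IH]; [simpl; ring |].
change (IZR (k * c) + x * peval (pscale k l) x = IZR k * (IZR c + x * peval l x)).
rewrite IH, mult_IZR. ring.
Qed.

Lemma peval_shift (n : nat) (l : list Z) (x : R) :
  peval (pshift n l) x = x ^ n * peval l x.
Proof.
induction n as [| n IH]; [unfold pshift; simpl; ring |].
change (0 + x * peval (pshift n l) x = x ^ S n * peval l x).
rewrite IH. simpl. ring.
Qed.

(* [taylor D k l] represents [l] at [(k + t) / D] as a polynomial in [t], up to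
   the common denominator returned as second component. *)
Fixpoint taylor (D k : Z) (l : list Z) : list Z * Z :=
  match l with
  | nil => (nil, 1%Z)
  | (c :: l)%list =>
      let (m, d) := taylor D k l in
      (padd ((c * (D * d))%Z :: m) (pscale k m), (D * d)%Z)
  end.

Lemma taylor_correct (D k : Z) (l : list Z) (t : R) :
  (0 < D)%Z ->
  (0 < snd (taylor D k l))%Z /\
  peval (fst (taylor D k l)) t =
    IZR (snd (taylor D k l)) * peval l ((IZR k + t) / IZR D).
Proof.
intros HD. assert (HD' : 0 < IZR D) by now apply IZR_lt.
induction l as [| c l [IH1 IH2]]; cbn [taylor]; [simpl; split; [lia | ring] |].
destruct (taylor D k l) as [m d]. cbn [fst snd] in *.
split; [lia |].
rewrite peval_add, peval_scale. cbn [peval].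
rewrite IH2, !mult_IZR. field. lra.
Qed.

(** Horner's scheme on [[0, 1]]: if [p >= b] there, then [t * p t >= min 0 b]. *)
Fixpoint lower_bound (l : list Z) : Z :=
  match l with
  | nil => 0
  | (c :: l)%list => c + Z.min 0 (lower_bound l)
  end.

Lemma lower_bound_correct (l : list Z) (t : R) :
  0 <= t <= 1 -> IZR (lower_bound l) <= peval l t.
Proof.
intros Ht. induction l as [| c l IH]; simpl; [lra |].
rewrite plus_IZR. apply Rplus_le_compat_l.
destruct (Z.min_spec 0 (lower_bound l)) as [[H ->] | [H ->]].
- apply IZR_lt in H. apply Rmult_le_pos; lra.
- apply IZR_le in H. nra.
Qed.

(** Splits [[k / D, (k + n) / D]] into [n] cells of length [1 / D] and re-expands the polynomial at
    the left end of each. *)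
Fixpoint nonneg_on (D k : Z) (n : nat) (l : list Z) : bool :=
  match n with
  | O => true
  | S n => (0 <=? lower_bound (fst (taylor D k l)))%Z && nonneg_on D (k + 1) n l
  end.

Lemma nonneg_on_correct (D k : Z) (n : nat) (l : list Z) (x : R) :
  nonneg_on D k (S n) l = true -> (0 < D)%Z ->
  IZR k <= x * IZR D <= IZR k + INR (S n) -> 0 <= peval l x.
Proof.
intros H HD. assert (HD' : 0 < IZR D) by now apply IZR_lt.
revert k H. induction n as [| n IH]; intros k H Hx;
  apply andb_prop in H; destruct H as [H H'].
all: destruct (Rle_lt_dec (x * IZR D) (IZR k + 1)) as [Hle | Hlt].
2: simpl in Hx; lra.
3: { apply (IH (k + 1)%Z H'). rewrite plus_IZR. rewrite S_INR in Hx. lra. }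
all: apply Z.leb_le in H; apply IZR_le in H;
  pose proof (lower_bound_correct (fst (taylor D k l)) (x * IZR D - IZR k)
    ltac:(lra)) as Hl;
  destruct (taylor_correct D k l (x * IZR D - IZR k) HD) as [Hd He];
  rewrite He in Hl; apply IZR_lt in Hd;
  replace ((IZR k + (x * IZR D - IZR k)) / IZR D) with x in Hl by (field; lra);
  apply Rmult_le_reg_l with (1 := Hd); lra.
Qed.

(* Coefficients in [q] of [E^n * theta_trunc n q (- (a / E) * q^j)]. *)
Fixpoint trunc_list (a E : Z) (n j : nat) : list Z :=
  match n with
  | O => (1%Z :: nil)%list
  | S n => ((E ^ Z.of_nat (S n))%Z
             :: pshift j (pscale (- a) (trunc_list a E n (S j))))%list
  end.

Lemma trunc_list_correct (a E : Z) (n j : nat) (q : R) :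
  (0 < E)%Z ->
  peval (trunc_list a E n j) q =
    IZR E ^ n * theta_trunc n q (- (IZR a / IZR E) * q ^ j).
Proof.
intros HE. assert (HE' : 0 < IZR E) by now apply IZR_lt.
revert j. induction n as [| n IH]; intros j.
  rewrite theta_trunc_0. simpl. ring.
change (peval (trunc_list a E (S n) j) q) with
  (IZR (E ^ Z.of_nat (S n)) +
    q * peval (pshift j (pscale (- a) (trunc_list a E n (S j)))) q).
rewrite peval_shift, peval_scale, IH, theta_trunc_S, <- pow_IZR, opp_IZR.
replace (q * (- (IZR a / IZR E) * q ^ j)) with (- (IZR a / IZR E) * q ^ S j)
  by (simpl; ring).
simpl pow. field. lra.
Qed.

(** The integer polynomial being certified is [E^n * (B * theta_trunc n q (- (a / E)) - b)], in the
    variable [q]. *)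
Lemma trunc_lower (a E b B D k : Z) (n m : nat) (q : R) :
  (0 < E)%Z -> (0 < D)%Z -> (0 < B)%Z ->
  nonneg_on D k (S m)
    (padd (pscale B (trunc_list a E n 0)) ((- b * E ^ Z.of_nat n)%Z :: nil))
    = true ->
  IZR k <= q * IZR D <= IZR k + INR (S m) ->
  IZR b / IZR B <= theta_trunc n q (- (IZR a / IZR E)).
Proof.
intros HE HD HB H Hq.
apply nonneg_on_correct with (x := q) in H; [| easy | easy].
rewrite peval_add, peval_scale, trunc_list_correct in H by easy.
simpl in H. rewrite mult_IZR, opp_IZR, <- pow_IZR, !Rmult_1_r, Rmult_0_r in H.
apply IZR_lt in HE. apply IZR_lt in HB.
assert (0 < IZR E ^ n) by now apply pow_lt.
apply Rmult_le_reg_l with (IZR B); [easy |].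
apply Rmult_le_reg_l with (IZR E ^ n); [easy |].
replace (IZR E ^ n * (IZR B * (IZR b / IZR B))) with (IZR E ^ n * IZR b)
  by (field; lra).
lra.
Qed.

(** * Truncation bounds on the bases and on the walls away from q = 1 *)

Lemma theta_wall_21_2 (q : R) :
  0.4 <= q <= 2 / 3 -> 0.0049 <= theta q (- (21 / 2)).
Proof.
intros Hq. replace 0.0049 with (49 / 10000) by lra.
assert (Hp : forall n r, (r ^ S n * (21 / 2) <= 1) -> q <= r ->
    if Nat.even n then theta q (- (21 / 2)) <= theta_trunc n q (- (21 / 2))
    else theta_trunc n q (- (21 / 2)) <= theta q (- (21 / 2))).
  intros n r Hr Hqr. apply theta_trunc_alternating; [lra | lra |].
  assert (q ^ S n <= r ^ S n) by (apply pow_incr; lra). lra.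
(* Odd truncations bound from below. Their order rises from 7 to 11 with [q], since the terms then
   decay more slowly. *)
destruct (Rle_lt_dec q (72 / 150)) as [H1 | H1];
  [| destruct (Rle_lt_dec q (80 / 150)) as [H2 | H2];
  [| destruct (Rle_lt_dec q (18 / 30)) as [H3 | H3]]].
- apply Rle_trans with (theta_trunc 7 q (- (21 / 2))).
  + apply (trunc_lower 21 2 49 10000 50 20 7 3);
      [lia | lia | lia | vm_compute; reflexivity | simpl; lra].
  + apply (Hp 7%nat (72 / 150)); [simpl; lra | lra].
- apply Rle_trans with (theta_trunc 9 q (- (21 / 2))).
  + apply (trunc_lower 21 2 49 10000 150 72 9 7);
      [lia | lia | lia | vm_compute; reflexivity | simpl; lra].
  + apply (Hp 9%nat (80 / 150)); [simpl; lra | lra].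
- apply Rle_trans with (theta_trunc 9 q (- (21 / 2))).
  + apply (trunc_lower 21 2 49 10000 30 16 9 1);
      [lia | lia | lia | vm_compute; reflexivity | simpl; lra].
  + apply (Hp 9%nat (18 / 30)); [simpl; lra | lra].
- apply Rle_trans with (theta_trunc 11 q (- (21 / 2))).
  + apply (trunc_lower 21 2 49 10000 30 18 11 1);
      [lia | lia | lia | vm_compute; reflexivity | simpl; lra].
  + apply (Hp 11%nat (2 / 3)); [simpl; lra | lra].
Qed.

Lemma theta_wall_6 (q : R) : 1 / 6 <= q <= 0.4 -> 0.005 <= theta q (- 6).
Proof.
intros Hq. replace (-6) with (- (6 / 1)) by lra. replace 0.005 with (5 / 1000) by lra.
apply Rle_trans with (theta_trunc 5 q (- (6 / 1))).
- apply (trunc_lower 6 1 5 1000 100 16 5 23); try lia.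
    vm_compute. reflexivity.
  simpl. lra.
- apply (theta_trunc_alternating 5); [lra | lra |].
  assert (q ^ 6 <= 0.4 ^ 6) by (apply pow_incr; lra). lra.
Qed.

Lemma theta_base_2_5 (y : R) :
  0 <= y <= 21 / 2 -> 0.0049 <= theta 0.4 (- y).
Proof.
intros Hy. apply Rle_trans with (theta_trunc 5 0.4 (- y)).
(* The list holds the coefficients in [y] of [5^15 * 10^4 * (theta_trunc 5 (2/5) (- y) - 0.0049)],
   where [15 = tri 5]. *)
- assert (H : 0 <= peval (30517578125 * 9951 :: - 12207031250 * 10000
      :: 1953125000 * 10000 :: - 125000000 * 10000 :: 3200000 * 10000
      :: - 32768 * 10000 :: nil)%Z y).
    apply (nonneg_on_correct 2 0 20); [vm_compute; reflexivity | lia | simpl; lra].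
  rewrite !theta_trunc_S, theta_trunc_0. simpl in H.
  replace 0.4 with (2 / 5) by lra. lra.
- apply (theta_trunc_alternating 5); lra.
Qed.

(** * The two-sided theta series *)

(* Equals the two-sided sum of [(-1)^j q^(j(j+1)/2) y^j] over all integers [j]. *)
Definition bitheta (q y : R) : R := theta q (- y) - theta q (- / y) / y.

Lemma bitheta_1 (q : R) : bitheta q 1 = 0.
Proof. unfold bitheta. rewrite Rinv_1. lra. Qed.

(** Quasi-periodicity: with [q = exp (- s)] and [y = exp (s z)], dividing [y] by [q] is the shift of
    [z] by 1. *)
Lemma bitheta_step (q y : R) :
  0 < q < 1 -> 0 < y -> bitheta q (y / q) = - y * bitheta q y.
Proof.
intros Hq Hy. unfold bitheta.
rewrite (theta_functional q (- (y / q))), (theta_functional q (- / y)) by lra.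
replace (q * - (y / q)) with (- y) by (field; lra).
replace (- / (y / q)) with (q * - / y) by (field; lra).
field. lra.
Qed.

(* Coefficients in [y] of [3^36 y^n (theta_trunc (n-1) q (- / y) / y -
   theta_trunc (m-1) q (- y))] for [q = 2/3]; note [tri 8 = 36]. *)
Definition bitheta_list (n m : nat) : list Z :=
  let c j := ((-1) ^ Z.of_nat j * 2 ^ Z.of_nat (tri j)
    * 3 ^ (36 - Z.of_nat (tri j)))%Z in
  (List.map c (List.rev (List.seq 0 n))
    ++ List.map (fun j => - c j)%Z (List.seq 0 m))%list.

(** Initial data for the heat comparison: [1 <= y <= 1 / q] is one full period in [z] at
    [q = 2/3]. *)
Lemma bitheta_2_3 (y : R) :
  1 <= y <= 3 / 2 -> Rabs (bitheta (2 / 3) y) <= 45 / 1000000.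
Proof.
intros Hy.
assert (Hy' : 2 / 3 <= / y <= 1).
  split; [replace (2 / 3) with (/ (3 / 2)) by field | rewrite <- Rinv_1];
    apply Rinv_le_contravar; lra.
(* Consecutive truncations sandwich theta at both [y] and [/ y]; multiplying by [y^8] or [y^9] below
   clears the negative powers of [y]. *)
assert (B : forall x, 0 <= x <= 3 / 2 ->
    theta_trunc 7 (2 / 3) (- x) <= theta (2 / 3) (- x)
      <= theta_trunc 8 (2 / 3) (- x)).
  intros x Hx. split.
  - apply (theta_trunc_alternating 7); simpl; lra.
  - apply (theta_trunc_alternating 8); simpl; lra.
pose proof (B y ltac:(lra)) as B1. pose proof (B (/ y) ltac:(lra)) as B2.
assert (U : theta_trunc 8 (2 / 3) (- y) - theta_trunc 7 (2 / 3) (- / y) / y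
    <= 45 / 1000000).
  set (l := padd (pscale 1000000 (bitheta_list 8 9))
    (pshift 8 ((45 * 3 ^ 36)%Z :: nil))).
  assert (H : 0 <= peval l y)
    by (apply (nonneg_on_correct 20 20 9);
      [vm_compute; reflexivity | lia | simpl; lra]).
  let v := eval vm_compute in l in change l with v in H.
  cbn [peval] in H.
  rewrite !theta_trunc_S, !theta_trunc_0.
  apply Rmult_le_reg_l with (1000000 * 3 ^ 36 * y ^ 8);
    [apply Rmult_lt_0_compat; [lra | apply pow_lt; lra] |].
  apply Rminus_le_0. eapply Rle_trans; [exact H |]. apply Req_le.
  field. lra.
assert (L : - (45 / 1000000) <=
    theta_trunc 7 (2 / 3) (- y) - theta_trunc 8 (2 / 3) (- / y) / y).
  set (l := padd (pscale (- 1000000) (bitheta_list 9 8))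
    (pshift 9 ((45 * 3 ^ 36)%Z :: nil))).
  assert (H : 0 <= peval l y)
    by (apply (nonneg_on_correct 20 20 9);
      [vm_compute; reflexivity | lia | simpl; lra]).
  let v := eval vm_compute in l in change l with v in H.
  cbn [peval] in H.
  rewrite !theta_trunc_S, !theta_trunc_0.
  apply Rmult_le_reg_l with (1000000 * 3 ^ 36 * y ^ 9);
    [apply Rmult_lt_0_compat; [lra | apply pow_lt; lra] |].
  apply Rminus_le_0. eapply Rle_trans; [exact H |]. apply Req_le.
  field. lra.
assert (M : forall u v, u <= v -> u / y <= v / y).
  intros u v Huv. apply Rmult_le_compat_r; lra.
pose proof (M _ _ (proj1 B2)). pose proof (M _ _ (proj2 B2)).
unfold bitheta. apply Rabs_le. lra.
Qed.

(** * Comparison with the heat equation *)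

Definition heat_kernel (t x : R) : R := exp (- (x ^ 2 / (4 * t))) / sqrt t.

Lemma is_derive_heat_kernel_t (t x : R) :
  0 < t -> is_derive (fun t => heat_kernel t x) t
    ((x ^ 2 / (4 * t ^ 2) - / (2 * t)) * heat_kernel t x).
Proof.
intros Ht. unfold heat_kernel.
assert (Hs : 0 < sqrt t) by now apply sqrt_lt_R0.
auto_derive; [repeat split; lra |].
replace (x * (x * 1) * / (4 * t)) with (x ^ 2 / (4 * t)) by (field; lra).
set (E := exp _).
replace (/ (2 * t)) with (/ (2 * (sqrt t * sqrt t))) by (rewrite sqrt_sqrt; lra).
field. lra.
Qed.

Lemma is_derive_heat_kernel_x (t x : R) :
  0 < t -> is_derive (fun x => heat_kernel t x) x
    (- (x / (2 * t)) * heat_kernel t x).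
Proof.
intros Ht. unfold heat_kernel.
assert (Hs : 0 < sqrt t) by now apply sqrt_lt_R0.
auto_derive; [easy |].
replace (x * (x * 1) * / (4 * t)) with (x ^ 2 / (4 * t)) by (field; lra).
set (E := exp _). field. lra.
Qed.

(** The value equals the derivative in [t], so [u_t = u_xx]: the kernel is the fundamental solution
    up to the factor [1 / sqrt (4 pi)]. *)
Lemma is_derive_heat_kernel_xx (t x : R) :
  0 < t -> is_derive (fun x => - (x / (2 * t)) * heat_kernel t x) x
    ((x ^ 2 / (4 * t ^ 2) - / (2 * t)) * heat_kernel t x).
Proof.
intros Ht. evar_last.
  apply (is_derive_mult (fun x => - (x / (2 * t))) (heat_kernel t)).
    auto_derive; [easy | reflexivity].
    now apply is_derive_heat_kernel_x.
  intros; apply Rmult_comm.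
unfold plus, mult; simpl. field. lra.
Qed.

Lemma continuity_2d_heat_kernel (f : R -> R -> R) (t z : R) :
  0 < t -> continuity_2d_pt f t z ->
  continuity_2d_pt (fun t z => heat_kernel t (f t z)) t z.
Proof.
intros Ht Hf. unfold heat_kernel, Rdiv.
apply continuity_2d_pt_mult.
- apply (continuity_1d_2d_pt_comp exp);
    [apply derivable_continuous, derivable_exp |].
  apply continuity_2d_pt_opp, continuity_2d_pt_mult;
    [now apply continuity_2d_pow |].
  apply continuity_2d_pt_inv; [| lra].
  apply continuity_2d_pt_mult;
    [apply continuity_2d_pt_const | apply continuity_2d_pt_id1].
- apply continuity_2d_pt_inv; [| apply Rgt_not_eq, sqrt_lt_R0; easy].
  apply (continuity_1d_2d_pt_comp sqrt); [| apply continuity_2d_pt_id1].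
  apply continuity_pt_sqrt. lra.
Qed.

Lemma exp_pow (x : R) (n : nat) : exp x ^ n = exp (INR n * x).
Proof.
induction n as [| n IH]; [simpl; rewrite Rmult_0_l, exp_0; ring |].
rewrite S_INR. simpl. rewrite IH, <- exp_plus. f_equal. ring.
Qed.

(* An alternating array of heat sources at the half-integers, hence vanishing on
   integers; in the variables [q = exp (- s)], [y = exp (s z)], [s = 1 / (2 t)],
   completing the square turns each term of [bitheta] into such a source. *)
Definition source (j : nat) (t z : R) : R :=
  (-1) ^ j * (heat_kernel t (z - (INR j + / 2)) - heat_kernel t (z + (INR j + / 2))).

(** The Gaussian factor is common to all terms, so the identity already holds for partial sums;
    these are exact heat solutions approximating [bitheta]. *)
Lemma sum_source (n : nat) (t z : R) :
  0 < t ->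
  sum_n (fun j => source j t z) n =
    heat_kernel t (z - / 2) *
      (theta_trunc n (exp (- / (2 * t))) (- exp (z / (2 * t)))
       - theta_trunc n (exp (- / (2 * t))) (- / exp (z / (2 * t)))
         / exp (z / (2 * t))).
Proof.
intros Ht.
assert (Hs : 0 < sqrt t) by now apply sqrt_lt_R0.
assert (T : forall j, source j t z = heat_kernel t (z - / 2) *
      (theta_coef (exp (- / (2 * t))) (- exp (z / (2 * t))) j
       - theta_coef (exp (- / (2 * t))) (- / exp (z / (2 * t))) j
         / exp (z / (2 * t)))).
  intros j. unfold theta_coef, source, heat_kernel.
  fold (tri j). pose proof (tri_double j) as Hj.
  unfold Rdiv at 8. rewrite <- exp_Ropp.
  replace (- exp (z / (2 * t))) with (-1 * exp (z / (2 * t))) by ring.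
  replace (- exp (- (z / (2 * t)))) with (-1 * exp (- (z / (2 * t)))) by ring.
  rewrite !Rpow_mult_distr, !exp_pow.
  replace (- ((z - (INR j + / 2)) ^ 2 / (4 * t))) with
    (- ((z - / 2) ^ 2 / (4 * t)) + (INR (tri j) * - / (2 * t)
      + INR j * (z / (2 * t)))).
  2: { apply Rmult_eq_reg_l with (4 * t); [| lra]. field_simplify; [nra | lra | lra]. }
  replace (- ((z + (INR j + / 2)) ^ 2 / (4 * t))) with
    (- ((z - / 2) ^ 2 / (4 * t)) + (INR (tri j) * - / (2 * t)
      + (INR j * (- (z / (2 * t))) + - (z / (2 * t))))).
  2: { apply Rmult_eq_reg_l with (4 * t); [| lra]. field_simplify; [nra | lra | lra]. }
  rewrite !exp_plus. field. lra.
induction n as [| n IH].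
- rewrite sum_O, T. now rewrite !theta_trunc_0, !theta_coef_0.
- rewrite sum_Sn, IH, T, !theta_trunc_last. unfold plus. simpl. lra.
Qed.

Lemma exp_monotone (x y : R) : x <= y -> exp x <= exp y.
Proof.
intros [H | ->]; [left; now apply exp_increasing | apply Rle_refl].
Qed.

(* The barrier [C exp (- 6 (t - t0)) (1 - 3 (z - 1/2)^2)] is a supersolution of
   the heat equation and is at least [C / 4 exp (- 6 (t - t0))] on [0, 1]. *)
Lemma bitheta_heat_bound (t0 M sgn : R) :
  0 < t0 -> Rabs sgn <= 1 ->
  (forall y, 1 <= y <= exp (/ (2 * t0)) ->
    Rabs (bitheta (exp (- / (2 * t0))) y) <= M) ->
  forall t z, t0 <= t -> 0 <= z <= 1 ->
    0 <= 4 * M / sqrt t0 * exp (- 6 * (t - t0)) * (1 - 3 * (z - / 2) ^ 2)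
      + sgn * (heat_kernel t (z - / 2)
          * bitheta (exp (- / (2 * t))) (exp (z / (2 * t)))).
Proof.
intros Ht0 Hsgn HM t1 z Ht1 Hz.
assert (Hs0 : 0 < sqrt t0) by now apply sqrt_lt_R0.
assert (HM0 : 0 <= M).
  apply Rle_trans with (2 := HM 1 ltac:(split; [lra |];
    rewrite <- exp_0; apply exp_monotone; left; apply Rinv_0_lt_compat; lra)).
  apply Rabs_pos.
set (C := 4 * M / sqrt t0).
assert (HC : 0 <= C) by (apply Rmult_le_pos; [lra |];
  left; now apply Rinv_0_lt_compat).
set (B := fun t z : R => C * exp (- 6 * (t - t0)) * (1 - 3 * (z - / 2) ^ 2)).
set (Bt := fun t z : R => - 6 * B t z).
set (Bz := fun t z : R => C * exp (- 6 * (t - t0)) * (- 6 * (z - / 2))).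
set (Bzz := fun t z : R => - 6 * (C * exp (- 6 * (t - t0)))).
set (g1 := fun (j : nat) (t z : R) => (-1) ^ j *
  (- ((z - (INR j + / 2)) / (2 * t)) * heat_kernel t (z - (INR j + / 2))
   - - ((z + (INR j + / 2)) / (2 * t)) * heat_kernel t (z + (INR j + / 2)))).
set (g2 := fun (j : nat) (t z : R) => (-1) ^ j *
  (((z - (INR j + / 2)) ^ 2 / (4 * t ^ 2) - / (2 * t))
      * heat_kernel t (z - (INR j + / 2))
   - ((z + (INR j + / 2)) ^ 2 / (4 * t ^ 2) - / (2 * t))
      * heat_kernel t (z + (INR j + / 2)))).
assert (Hq : forall t, t0 <= t -> exp (- / (2 * t0)) <= exp (- / (2 * t)) < 1).
  intros t Ht. rewrite <- exp_0. split.
  - apply exp_monotone, Ropp_le_contravar, Rinv_le_contravar; lra.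
  - apply exp_increasing, Ropp_lt_gt_0_contravar, Rinv_0_lt_compat. lra.
assert (Hk : forall t x, t0 <= t -> 0 < heat_kernel t x <= / sqrt t0).
  intros t x Ht. unfold heat_kernel.
  assert (Hs : sqrt t0 <= sqrt t) by now apply sqrt_le_1_alt.
  split; [apply Rdiv_lt_0_compat; [apply exp_pos | lra] |].
  rewrite <- (Rmult_1_l (/ sqrt t0)).
  apply Rmult_le_compat; [left; apply exp_pos | | |].
  - left. apply Rinv_0_lt_compat. lra.
  - rewrite <- exp_0. apply exp_monotone.
    assert (0 <= x ^ 2 / (4 * t)); [| lra].
    apply Rmult_le_pos; [apply pow2_ge_0 | left; apply Rinv_0_lt_compat; lra].
  - apply Rinv_le_contravar; lra.
assert (Hy : forall t z, t0 <= t -> 0 <= z <= 1 ->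
    1 <= exp (z / (2 * t)) <= exp (/ (2 * t0))).
  intros t x Ht Hx.
  assert (0 < / (2 * t) <= / (2 * t0)).
    split; [apply Rinv_0_lt_compat | apply Rinv_le_contravar]; lra.
  rewrite <- exp_0. split; apply exp_monotone; unfold Rdiv; nra.
(* The sum of [g2] serves both as time derivative and as second space derivative of the sources;
   only the barrier [B] makes the two differ. *)
apply (parabolic_min_limit
  (fun n t z => B t z + sgn * sum_n (fun j => source j t z) n)
  (fun n t z => Bt t z + sgn * sum_n (fun j => g2 j t z) n)
  (fun n t z => Bz t z + sgn * sum_n (fun j => g1 j t z) n)
  (fun n t z => Bzz t z + sgn * sum_n (fun j => g2 j t z) n)
  (fun t z => B t z + sgn * (heat_kernel t (z - / 2)
          * bitheta (exp (- / (2 * t))) (exp (z / (2 * t)))))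
  (fun n => 2 / sqrt t0 * (theta (exp (- / (2 * t1))) (exp (/ (2 * t0)))
     - theta_trunc n (exp (- / (2 * t1))) (exp (/ (2 * t0)))))
  t0 t1 0 1 0); try lra.
- intros n t x Ht Hx.
  apply (continuity_2d_pt_plus B).
  + unfold B. apply continuity_2d_pt_mult; [apply continuity_2d_pt_mult |].
    * apply continuity_2d_pt_const.
    * apply (continuity_1d_2d_pt_comp exp);
        [apply derivable_continuous, derivable_exp |].
      apply continuity_2d_pt_mult; [apply continuity_2d_pt_const |].
      apply continuity_2d_pt_minus;
        [apply continuity_2d_pt_id1 | apply continuity_2d_pt_const].
    * apply continuity_2d_pt_minus; [apply continuity_2d_pt_const |].
      apply continuity_2d_pt_mult; [apply continuity_2d_pt_const |].
      apply continuity_2d_pow, continuity_2d_pt_minus;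
        [apply continuity_2d_pt_id2 | apply continuity_2d_pt_const].
  + apply (continuity_2d_pt_mult (fun _ _ => sgn));
      [apply continuity_2d_pt_const |].
    apply continuity_2d_sum. intros j. unfold source.
    apply continuity_2d_pt_mult; [apply continuity_2d_pt_const |].
    apply continuity_2d_pt_minus; apply continuity_2d_heat_kernel;
      try lra; [apply continuity_2d_pt_minus | apply continuity_2d_pt_plus];
      (apply continuity_2d_pt_id2 || apply continuity_2d_pt_const).
- intros n t x Ht Hx.
  assert (Lt : forall c, is_derive (fun t => heat_kernel t (x + c)) t
      (((x + c) ^ 2 / (4 * t ^ 2) - / (2 * t)) * heat_kernel t (x + c)))
    by (intros c; apply is_derive_heat_kernel_t; lra).
  assert (Lsh : forall (h : R -> R) l c, is_derive h (x + c) l ->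
      is_derive (fun x => h (x + c)) x l).
    intros h l c Hh.
    assert (H1 : is_derive (fun x => x + c) x 1)
      by (auto_derive; [easy | ring]).
    pose proof (is_derive_comp h (fun x => x + c) x l 1 Hh H1) as H2.
    unfold scal in H2; simpl in H2; unfold mult in H2; simpl in H2.
    now rewrite Rmult_1_l in H2.
  split; [| split].
  + apply (is_derive_plus (fun t => B t x)).
      unfold Bt, B. auto_derive; [easy | unfold Rminus; ring].
    apply (is_derive_scal (fun t => sum_n (fun j => source j t x) n)).
    apply (is_derive_sum_n_R (fun j t => source j t x) (fun j t => g2 j t x)).
    intros j. apply (is_derive_scal (fun t => heat_kernel t (x - (INR j + / 2))
      - heat_kernel t (x + (INR j + / 2)))).
    apply (is_derive_minus (fun t => heat_kernel t (x - (INR j + / 2)))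
      (fun t => heat_kernel t (x + (INR j + / 2)))); apply Lt.
  + apply (is_derive_plus (fun x => B t x)).
      unfold B, Bz. auto_derive; [easy | unfold Rminus; ring].
    apply (is_derive_scal (fun x => sum_n (fun j => source j t x) n)).
    apply (is_derive_sum_n_R (fun j x => source j t x) (fun j x => g1 j t x)).
    intros j. apply (is_derive_scal (fun x => heat_kernel t (x - (INR j + / 2))
      - heat_kernel t (x + (INR j + / 2)))).
    apply (is_derive_minus (fun x => heat_kernel t (x - (INR j + / 2)))
      (fun x => heat_kernel t (x + (INR j + / 2))));
      apply (Lsh (heat_kernel t)), is_derive_heat_kernel_x; lra.
  + apply (is_derive_plus (fun x => Bz t x)).
      unfold Bz, Bzz. auto_derive; [easy | unfold Rminus; ring].
    apply (is_derive_scal (fun x => sum_n (fun j => g1 j t x) n)).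
    apply (is_derive_sum_n_R (fun j x => g1 j t x) (fun j x => g2 j t x)).
    set (k1 := fun x => - (x / (2 * t)) * heat_kernel t x).
    intros j. apply (is_derive_scal (fun x => k1 (x - (INR j + / 2))
      - k1 (x + (INR j + / 2)))).
    apply (is_derive_minus (fun x => k1 (x - (INR j + / 2)))
      (fun x => k1 (x + (INR j + / 2))));
      apply (Lsh k1), is_derive_heat_kernel_xx; lra.
(* [Bt - Bzz = 18 * C * exp (- 6 * (t - t0)) * (z - 1/2)^2], which is nonnegative. *)
- intros n t x Ht Hx _ H.
  apply Rle_trans with (1 := H), Rplus_le_compat_r.
  unfold Bt, Bzz, B. pose proof (exp_pos (- 6 * (t - t0))) as He.
  pose proof (Rmult_le_pos _ _ HC (Rlt_le _ _ He)).
  pose proof (pow2_ge_0 (x - / 2)). nra.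
- intros n t x Ht Hx.
  rewrite sum_source by lra.
  set (q := exp (- / (2 * t))). set (y := exp (x / (2 * t))).
  set (e := theta _ _ - theta_trunc _ _ _).
  assert (Hyb : 1 <= y <= exp (/ (2 * t0))) by (apply Hy; lra).
  assert (Hiy : 0 < / y <= 1).
    split; [apply Rinv_0_lt_compat; lra |].
    rewrite <- Rinv_1. apply Rinv_le_contravar; lra.
  assert (Hqb : 0 <= q <= exp (- / (2 * t1))).
    split; [left; apply exp_pos |].
    apply exp_monotone, Ropp_le_contravar, Rinv_le_contravar; lra.
  assert (E1 : Rabs (theta_trunc n q (- y) - theta q (- y)) <= e).
    apply theta_trunc_error; [easy | apply Hq; lra |].
    rewrite Rabs_Ropp, Rabs_pos_eq; lra.
  assert (E2 : Rabs (theta_trunc n q (- / y) - theta q (- / y)) <= e).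
    apply theta_trunc_error; [easy | apply Hq; lra |].
    rewrite Rabs_Ropp, Rabs_pos_eq; lra.
  specialize (Hk t (x - / 2) ltac:(lra)).
  unfold bitheta.
  match goal with |- Rabs ?a <= _ => replace a with (sgn * (heat_kernel t (x - / 2) *
    ((theta_trunc n q (- y) - theta q (- y))
     - (theta_trunc n q (- / y) - theta q (- / y)) * / y)))
    by (unfold Rdiv; ring) end.
  set (d1 := theta_trunc n q (- y) - theta q (- y)) in *.
  set (d2 := theta_trunc n q (- / y) - theta q (- / y)) in *.
  assert (E : Rabs (d1 - d2 * / y) <= 2 * e).
    apply Rabs_le_between in E1. apply Rabs_le_between in E2.
    apply Rabs_le_between. nra.
  rewrite !Rabs_mult, (Rabs_pos_eq (heat_kernel _ _)) by lra.
  replace (2 / sqrt t0 * e) with (1 * (/ sqrt t0 * (2 * e))) by (field; lra).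
  apply Rmult_le_compat; [apply Rabs_pos | | easy |].
  + apply Rmult_le_pos; [lra | apply Rabs_pos].
  + apply Rmult_le_compat; [lra | apply Rabs_pos | lra | easy].
- replace (Finite 0) with (Rbar_mult (2 / sqrt t0) 0)
    by (simpl; f_equal; ring).
  apply is_lim_seq_scal_l, is_lim_theta_tail.
  split; [left; apply exp_pos | apply Hq; lra].
- intros x Hx. unfold B.
  replace (- 6 * (t0 - t0)) with 0 by ring. rewrite exp_0.
  specialize (HM _ (Hy t0 x ltac:(lra) Hx)).
  specialize (Hk t0 (x - / 2) ltac:(lra)).
  set (D := bitheta _ _) in *. set (K := heat_kernel _ _) in *.
  assert (E : Rabs (sgn * (K * D)) <= 1 * (/ sqrt t0 * M)).
    rewrite !Rabs_mult, (Rabs_pos_eq K) by lra.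
    apply Rmult_le_compat; [apply Rabs_pos | | easy |].
    + apply Rmult_le_pos; [lra | apply Rabs_pos].
    + apply Rmult_le_compat; [lra | apply Rabs_pos | lra | easy].
  apply Rabs_le_between in E.
  assert (C = 4 * (/ sqrt t0 * M)) by (unfold C; field; lra).
  assert (0 <= C * (/ 4 - (x - / 2) ^ 2)); [| nra].
  apply Rmult_le_pos; [easy | nra].
- intros t Ht.
  assert (W0 : bitheta (exp (- / (2 * t))) (exp (0 / (2 * t))) = 0)
    by (unfold Rdiv; rewrite Rmult_0_l, exp_0; apply bitheta_1).
  (* The wall [z = 1] is [y = 1 / q], one quasi-period away from the zero at [y = 1]. *)
  assert (W1 : bitheta (exp (- / (2 * t))) (exp (1 / (2 * t))) = 0).
    replace (exp (1 / (2 * t))) with (1 / exp (- / (2 * t))).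
      rewrite bitheta_step; [rewrite bitheta_1; ring | | lra].
      split; [apply exp_pos | apply Hq; lra].
    rewrite exp_Ropp. unfold Rdiv. now rewrite Rinv_inv, Rmult_1_l, Rmult_1_l.
  rewrite W0, W1.
  assert (0 <= C * exp (- 6 * (t - t0)))
    by (apply Rmult_le_pos; [easy | left; apply exp_pos]).
  unfold B. lra.
Qed.

(** On [0 <= z <= 1], use the comparison with both signs. Then shift by units: the factor
    [exp ((z - 1) / (2 * t))] from [bitheta_step] is exactly the ratio of the Gaussian factors at
    [z] and [z - 1]. *)
Lemma bitheta_bound (t0 M : R) :
  0 < t0 ->
  (forall y, 1 <= y <= exp (/ (2 * t0)) ->
    Rabs (bitheta (exp (- / (2 * t0))) y) <= M) ->
  forall t z, t0 <= t -> 0 <= z ->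
    Rabs (bitheta (exp (- / (2 * t))) (exp (z / (2 * t)))) <=
      4 * M * (sqrt t / sqrt t0) * exp ((z - / 2) ^ 2 / (4 * t) - 6 * (t - t0)).
Proof.
intros Ht0 HM t z Ht Hz.
assert (Hs0 : 0 < sqrt t0) by now apply sqrt_lt_R0.
assert (Hs : 0 < sqrt t) by (apply sqrt_lt_R0; lra).
assert (HM0 : 0 <= M).
  apply Rle_trans with (2 := HM 1 ltac:(split; [lra |];
    rewrite <- exp_0; apply exp_monotone; left; apply Rinv_0_lt_compat; lra)).
  apply Rabs_pos.
assert (Hq : 0 < exp (- / (2 * t)) < 1).
  split; [apply exp_pos |]. rewrite <- exp_0.
  apply exp_increasing, Ropp_lt_gt_0_contravar, Rinv_0_lt_compat. lra.
assert (H : forall (n : nat) z, INR n <= z <= INR n + 1 ->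
    Rabs (bitheta (exp (- / (2 * t))) (exp (z / (2 * t)))) <=
      4 * M * (sqrt t / sqrt t0) * exp ((z - / 2) ^ 2 / (4 * t) - 6 * (t - t0))).
  induction n as [| n IH]; intros x Hx.
  - simpl in Hx.
    pose proof (bitheta_heat_bound t0 M 1 Ht0
      ltac:(rewrite Rabs_R1; lra) HM t x Ht ltac:(lra)) as H1.
    pose proof (bitheta_heat_bound t0 M (-1) Ht0
      ltac:(rewrite Rabs_left; lra) HM t x Ht ltac:(lra)) as H2.
    set (D := bitheta _ _) in *.
    replace (exp ((x - / 2) ^ 2 / (4 * t) - 6 * (t - t0))) with
      (exp ((x - / 2) ^ 2 / (4 * t)) * exp (- 6 * (t - t0)))
      by (rewrite <- exp_plus; f_equal; ring).
    set (E := exp (- 6 * (t - t0))) in *.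
    assert (HE : 0 < E) by apply exp_pos.
    unfold heat_kernel in *. rewrite exp_Ropp in *.
    set (G := exp ((x - / 2) ^ 2 / (4 * t))) in *.
    assert (HG : 0 < G) by apply exp_pos.
    assert (HC : 0 <= 4 * M / sqrt t0 * E).
      apply Rmult_le_pos; [apply Rmult_le_pos; [lra |] | lra].
      left. now apply Rinv_0_lt_compat.
    pose proof (pow2_ge_0 (x - / 2)) as Hw.
    replace (4 * M * (sqrt t / sqrt t0) * (G * E)) with
      (G * sqrt t * (4 * M / sqrt t0 * E)) by (field; lra).
    assert (HR : Rabs (/ G / sqrt t * D) <= 4 * M / sqrt t0 * E)
      by (apply Rabs_le; nra).
    replace D with (G * sqrt t * (/ G / sqrt t * D)) by (field; lra).
    assert (0 < G * sqrt t) by now apply Rmult_lt_0_compat.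
    rewrite Rabs_mult, (Rabs_pos_eq (G * sqrt t)) by lra.
    apply Rmult_le_compat_l; lra.
  - rewrite S_INR in Hx. specialize (IH (x - 1) ltac:(lra)).
    assert (Ex : exp (x / (2 * t)) * exp (- / (2 * t)) = exp ((x - 1) / (2 * t)))
      by (rewrite <- exp_plus; f_equal; field; lra).
    replace (exp (x / (2 * t)))
      with (exp ((x - 1) / (2 * t)) / exp (- / (2 * t)))
      by (rewrite <- Ex; field; lra).
    rewrite bitheta_step by (try apply exp_pos; easy).
    rewrite Rabs_mult, Rabs_Ropp, Rabs_pos_eq by (left; apply exp_pos).
    replace ((x - / 2) ^ 2 / (4 * t) - 6 * (t - t0)) with
      ((x - 1) / (2 * t) + ((x - 1 - / 2) ^ 2 / (4 * t) - 6 * (t - t0)))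
      by (field; lra).
    rewrite (exp_plus ((x - 1) / (2 * t))).
    pose proof (exp_pos ((x - 1) / (2 * t))).
    apply Rmult_le_compat_l with (r := exp ((x - 1) / (2 * t))) in IH; lra.
destruct (nfloor_ex z Hz) as [n Hn].
apply (H n). lra.
Qed.

(** * Explicit constants and the wall near q = 1 *)

Lemma exp_1_le : exp 1 <= 11 / 4.
Proof.
(* From [1 - 1/64 <= exp (- 1/64)], raised to the power 64. *)
assert (H : (63 / 64) ^ 64 <= / exp 1).
  rewrite <- exp_Ropp. replace (Ropp 1) with (INR 64 * (- / 64)) by (simpl; lra).
  rewrite <- exp_pow. apply pow_incr.
  pose proof (exp_ineq1_le (- / 64)). lra.
assert (H1 : 4 / 11 <= / exp 1) by (apply Rle_trans with (2 := H); simpl; lra).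
rewrite <- (Rinv_inv (exp 1)). replace (11 / 4) with (/ (4 / 11)) by field.
apply Rinv_le_contravar; lra.
Qed.

Lemma ln_21_2 : 2.2 <= ln (21 / 2) <= 2.36.
Proof.
split.
- apply Rnot_lt_le. intros H.
  assert (E : (21 / 2) ^ 5 <= exp 1 ^ 11).
    rewrite <- (exp_ln (21 / 2)) at 1 by lra.
    rewrite !exp_pow. apply exp_monotone. simpl. lra.
  assert (exp 1 ^ 11 <= (11 / 4) ^ 11)
    by (apply pow_incr; split; [left; apply exp_pos | apply exp_1_le]).
  simpl in *. lra.
- rewrite <- (ln_exp 2.36). apply ln_le; [lra |].
  pose proof (exp_ge_taylor 0.59 4 ltac:(lra)) as H.
  replace 2.36 with (INR 4 * 0.59) by (simpl; lra).
  rewrite <- exp_pow. apply Rle_trans with (1.803 ^ 4); [lra |].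
  apply pow_incr. simpl in H. lra.
Qed.

Lemma ln_3_2 : 0.4 <= ln (3 / 2) <= 0.41.
Proof.
split.
- apply Rnot_lt_le. intros H.
  assert (E : (3 / 2) ^ 5 <= exp 1 ^ 2).
    rewrite <- (exp_ln (3 / 2)) at 1 by lra.
    rewrite !exp_pow. apply exp_monotone. simpl. lra.
  assert (exp 1 ^ 2 <= (11 / 4) ^ 2)
    by (apply pow_incr; split; [left; apply exp_pos | apply exp_1_le]).
  simpl in *. lra.
- rewrite <- (ln_exp 0.41). apply ln_le; [lra |].
  apply Rle_trans with (2 := exp_ge_taylor 0.41 3 ltac:(lra)). simpl. lra.
Qed.

(** Square root of [r <= exp (r - 1)]; it moves the factor [sqrt t] of [bitheta_bound] into the
    exponent. *)
Lemma sqrt_le_exp (r : R) : 0 <= r -> sqrt r <= exp ((r - 1) / 2).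
Proof.
intros Hr. rewrite <- (sqrt_pow2 (exp ((r - 1) / 2))) by (left; apply exp_pos).
apply sqrt_le_1_alt. rewrite exp_pow.
replace (INR 2 * ((r - 1) / 2)) with (r - 1) by (simpl; field).
pose proof (exp_ineq1_le (r - 1)). lra.
Qed.

(** The one-sided part [theta q (- 2/21) * 2/21] is at least [(1 - 2/21) * 2/21 > 0.086], while
    [bitheta] is at most 0.08 in absolute value. *)
Lemma theta_wall_21_2_near_1 (q : R) :
  2 / 3 <= q < 1 -> 0.0049 <= theta q (- (21 / 2)).
Proof.
intros Hq.
pose proof ln_21_2 as Hl. pose proof ln_3_2 as Hs0.
set (l := ln (21 / 2)) in *. set (s0 := ln (3 / 2)) in *.
set (s := - ln q).
assert (Hs : 0 < s <= s0).
  unfold s, s0. split.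
  - assert (ln q < 0); [| lra]. rewrite <- ln_1. apply ln_increasing; lra.
  - rewrite <- ln_Rinv by lra. apply ln_le; [apply Rinv_0_lt_compat; lra |].
    replace (3 / 2) with (/ (2 / 3)) by field. apply Rinv_le_contravar; lra.
set (t0 := / (2 * s0)). set (t := / (2 * s)).
assert (E0 : / (2 * t0) = s0) by (unfold t0; field; lra).
assert (E : / (2 * t) = s) by (unfold t; field; lra).
assert (Ht0 : 0 < t0 <= 1.25).
  unfold t0. split; [apply Rinv_0_lt_compat; lra |].
  replace 1.25 with (/ (4 / 5)) by lra. apply Rinv_le_contravar; lra.
assert (Ht : t0 <= t) by (apply Rinv_le_contravar; lra).
assert (Q0 : exp (- s0) = 2 / 3).
  unfold s0. rewrite exp_Ropp, exp_ln by lra. field.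
assert (Q : exp (- s) = q) by (unfold s; rewrite Ropp_involutive, exp_ln; lra).
assert (HB : Rabs (bitheta q (21 / 2)) <= 0.08).
  assert (HM : forall y, 1 <= y <= exp (/ (2 * t0)) ->
      Rabs (bitheta (exp (- / (2 * t0))) y) <= 45 / 1000000).
    intros y. rewrite E0, Q0. unfold s0. rewrite exp_ln by lra.
    apply bitheta_2_3.
  (* The choice [z = 2 * t * l] makes [exp (z / (2 * t))] equal to [21 / 2]. *)
  assert (Hz : 0 <= l * (2 * t)) by (apply Rmult_le_pos; lra).
  pose proof (bitheta_bound t0 _ (proj1 Ht0) HM t (l * (2 * t)) Ht Hz) as H.
  replace (l * (2 * t) / (2 * t)) with l in H by (field; lra).
  rewrite E, Q in H. unfold l in H at 1. rewrite exp_ln in H by lra.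
  apply Rle_trans with (1 := H).
  rewrite <- sqrt_div by lra.
  assert (Hr : 0 <= t / t0)
    by (apply Rmult_le_pos; [lra | left; apply Rinv_0_lt_compat; lra]).
  apply Rle_trans with (4 * (45 / 1000000) * exp 6).
  2: { assert (exp 6 <= (11 / 4) ^ 6).
         replace 6 with (INR 6 * 1) at 1 by (simpl; lra). rewrite <- exp_pow.
         apply pow_incr. split; [left; apply exp_pos | apply exp_1_le].
       simpl in *. lra. }
  rewrite Rmult_assoc. apply Rmult_le_compat_l; [lra |].
  apply Rle_trans with (exp ((t / t0 - 1) / 2) *
    exp ((l * (2 * t) - / 2) ^ 2 / (4 * t) - 6 * (t - t0))).
    apply Rmult_le_compat_r; [left; apply exp_pos | now apply sqrt_le_exp].
  rewrite <- exp_plus. apply exp_monotone.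
  replace ((t / t0 - 1) / 2) with ((t - t0) * / (2 * t0)) by (field; lra).
  replace ((l * (2 * t) - / 2) ^ 2 / (4 * t))
    with (t * l ^ 2 - l / 2 + / (2 * t) / 8) by (field; lra).
  rewrite E0, E.
  (* The exponent is [t0 * l^2 - l / 2 + s / 8 - (t - t0) * (6 - s0 - l^2)]. The last bracket is
     positive because [2.36^2 + 0.41 < 6], so the exponent stays below 6 for all [t >= t0]. *)
  assert (l ^ 2 <= 2.36 ^ 2) by (apply pow_incr; lra).
  assert (t0 * l ^ 2 <= 1.25 * 2.36 ^ 2)
    by (apply Rmult_le_compat; try lra; apply pow2_ge_0).
  assert (0 <= (t - t0) * (6 - s0 - l ^ 2)) by (apply Rmult_le_pos; lra).
  nra.
pose proof (theta_neg_ge_linear q (/ (21 / 2)) ltac:(lra)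
  ltac:(replace (/ (21 / 2)) with (2 / 21) by field; lra)) as HT.
unfold bitheta in HB. apply Rabs_le_between in HB.
set (T := theta q (- / (21 / 2))) in *.
replace (/ (21 / 2)) with (2 / 21) in * by field.
unfold Rdiv in HB at 2 4. replace (/ (21 * / 2)) with (2 / 21) in * by field.
lra.
Qed.

(** * Assembling the bounds *)

Lemma theta_ge_Qtilde (q x : R) : Qtilde (q, x) -> 0.0049 <= theta q x.
Proof.
intros [Hq Hx]. simpl in *.
destruct (Req_dec q 1) as [-> | Hq1].
- unfold theta. destruct Req_EM_T as [_ | E]; [| easy].
  replace 0.0049 with (0.0049 * (1 - x) / (1 - x)) by (field; lra).
  apply Rmult_le_compat_r; [left; apply Rinv_0_lt_compat; lra | lra].
- rewrite <- (Ropp_involutive x).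
  (* The time interval ends at the given [q < 1], so the limit [q = 1] is never approached. *)
  apply (theta_min_principle 0.4 q (21 / 2)); try lra.
  + exact theta_base_2_5.
  + intros r Hr. destruct (Rle_lt_dec r (2 / 3)).
    * apply theta_wall_21_2. lra.
    * apply theta_wall_21_2_near_1. lra.
Qed.

(** For [x < 0] there are three ranges: [q >= 0.4] lies in the rectangle; [q <= 1/6] gives
    [q * (- x) <= 1], where [theta_neg_ge] applies; between them the minimum principle starts from
    [q = 1/6]. *)
Lemma theta_pos_ge_neg6 (q x : R) : 0 < q < 1 -> -6 <= x -> 0 < theta q x.
Proof.
intros Hq Hx.
destruct (Rle_lt_dec 0 x) as [Hx0 | Hx0].
  pose proof (theta_ge_1 q x ltac:(lra) Hx0). lra.
assert (Hp : forall r y, 0 < r < 1 -> 0 <= y -> r * y <= 1 ->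
    1 - r * y + (r * y) ^ 2 * r * (1 - r ^ 2) <= theta r (- y))
  by (intros; apply theta_neg_ge; lra).
destruct (Rle_lt_dec 0.4 q) as [Hq4 | Hq4].
  pose proof (theta_ge_Qtilde q x) as H. unfold Qtilde in H. simpl in H. lra.
rewrite <- (Ropp_involutive x).
destruct (Rle_lt_dec q (1 / 6)) as [Hq6 | Hq6].
- specialize (Hp q (- x) Hq ltac:(lra) ltac:(nra)).
  assert (Hu : 0 < q * - x <= 1) by (split; [apply Rmult_lt_0_compat |]; nra).
  assert (0 < (q * - x) ^ 2 * q * (1 - q ^ 2)); [| lra].
  apply Rmult_lt_0_compat; [| nra].
  apply Rmult_lt_0_compat; [apply pow_lt |]; lra.
- apply Rlt_le_trans with 0.005; [lra |].
  apply (theta_min_principle (1 / 6) q 6); try lra.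
  + intros y Hy. specialize (Hp (1 / 6) y ltac:(lra) ltac:(lra) ltac:(lra)).
    nra.
  + intros r Hr. apply theta_wall_6. lra.
Qed.

(** Boundary points belong to the closure; closedness places them in the rectangle, where the lower
    bound is available. *)
Lemma closed_Qtilde : closed Qtilde.
Proof.
assert (HF : forall D : R -> Prop, closed D -> closed (fun p : R * R => D (fst p)))
  by (intros D; apply closed_comp; intros [u v]; apply continuous_fst).
assert (HS : forall D : R -> Prop, closed D -> closed (fun p : R * R => D (snd p)))
  by (intros D; apply closed_comp; intros [u v]; apply continuous_snd).
unfold Qtilde. apply closed_and; apply closed_and.
- apply (HF (fun u => 0.4 <= u)), closed_ge.
- apply (HF (fun u => u <= 1)), closed_le.
- apply (HS (fun u => -10.5 <= u)), closed_ge.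
- apply (HS (fun u => u <= 0)), closed_le.
Qed.

Theorem proposition2 :
  (forall q : R, 0 < q < 1 -> ~ exists x : R, x >= -6 /\ theta q x = 0) /\
  ((forall q x : R, Qtilde (q, x) -> theta q x <> 0) /\
   (forall q x : R, boundary Qtilde (q, x) -> theta q x >= 0.0049)).
Proof.
split; [| split].
- intros q Hq [x [Hx H0]].
  pose proof (theta_pos_ge_neg6 q x Hq ltac:(lra)). lra.
- intros q x H. pose proof (theta_ge_Qtilde q x H). lra.
- intros q x [H _]. apply Rle_ge, theta_ge_Qtilde.
  now apply closed_Qtilde.
Qed.
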